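(* Let $d$ and $k$ be integers with $1\le k\le d-1$. There are constants $c_1=c_1(d,k)>0$ and $c_2=c_2(d,k)>0$ such that the following holds. Let $\Lambda\subseteq\mathbb{R}^d$ be a $d$-dimensional lattice and let $K\subseteq\mathbb{R}^d$ be a $d$-dimensional compact convex body symmetric about the origin, and write $\lambda_i=\lambda_i(\Lambda,K)$ for $i=1,\dots,d$. Assume $\lambda_d\le 1$. Then $\Lambda\cap K$ can be covered by at most $c_2(\lambda_{k+1}\cdots\lambda_d)^{-1}$ $k$-dimensional affine subspaces of $\mathbb{R}^d$, and every family of $k$-dimensional affine subspaces of $\mathbb{R}^d$ covering $\Lambda\cap K$ has at least $c_1(\lambda_{k+1}\cdots\lambda_d)^{-1}$ members.
   Context: A $d$-dimensional lattice is the set of all integer linear combinations of $d$ linearly independent vectors of $\mathbb{R}^d$. For a lattice $\Lambda$ and a compact convex body $K$ symmetric about the origin ($K=-K$), the $i$th successive minimum is $\lambda_i(\Lambda,K)=\inf\{\lambda\in\mathbb{R}:\dim(\Lambda\cap(\lambda K))\ge i\}$, where $\dim$ denotes the dimension of the affine hull.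
   Formalization: In the definition of the successive minima the infimum is taken over λ > 0 instead of over all real λ; since K = −K, negative λ would also qualify and the infimum as written would be −∞. *)

(* Defs.v *)
From HB Require Import structures.
From mathcomp Require Import all_boot all_order all_algebra.
From mathcomp Require Import all_classical all_reals all_analysis.
Set Implicit Arguments. Unset Strict Implicit. Unset Printing Implicit Defensive.
Import Order.TTheory GRing.Theory Num.Theory numFieldNormedType.Exports.
Local Open Scope classical_set_scope.
Local Open Scope ring_scope.

Section Defs.
Variables (R : realType) (d : nat).
Notation vec := 'rV[R]_d.

Definition lattice_of (B : 'M[R]_d) : set vec :=
  [set x | exists z : 'rV[int]_d, x = map_mx intr z *m B].

Definition is_lattice (L : set vec) : Prop :=
  exists B : 'M[R]_d, row_free B /\ L = lattice_of B.

(* dim(aff S) >= i : S contains i+1 affinely independent points. *)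
Definition affdim_ge (S : set vec) (i : nat) : Prop :=
  exists (p : vec) (V : 'M[R]_(i, d)),
    [/\ S p, row_free V & forall j : 'I_i, S (p + row j V)].

Definition convex_set (K : set vec) : Prop :=
  forall x y (t : R), 0 <= t <= 1 -> K x -> K y -> K (t *: x + (1 - t) *: y).

Definition symmetric_set (K : set vec) : Prop := forall x, K x -> K (- x).

Definition sym_convex_body (K : set vec) : Prop :=
  [/\ compact K, convex_set K, symmetric_set K & affdim_ge K d].

Definition scale_set (l : R) (K : set vec) : set vec := [set l *: x | x in K].

Definition succ_min (L K : set vec) (i : nat) : R :=
  inf [set l : R | 0 < l /\ affdim_ge (L `&` scale_set l K) i].

Definition affine_subspace (k : nat) (A : set vec) : Prop :=
  exists (p : vec) (V : 'M[R]_(k, d)),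
    row_free V /\ A = [set p + c *m V | c in [set: 'rV[R]_k]].

Definition covers (n : nat) (F : 'I_n -> set vec) (S : set vec) : Prop :=
  forall x, S x -> exists i, F i x.

End Defs.

(* Main.v *)
(** Choose lattice vectors v_0, v_1, ... greedily, v_i being a nearly shortest
    lattice vector outside W_i = span(v_0, ..., v_{i-1}).  If mu_i is the
    infimum of the gauges of the lattice points outside W_i, then mu_i agrees
    with lambda_{i+1} up to a factor 2.

    Lower bound: K contains the grid of all sums of m_i v_i with
    0 <= m_i <= 1/(2 d mu_i).  Some k of the v-coordinates determine a point of
    a k-dimensional affine subspace, and since the sides of the grid decrease
    with i, such a subspace contains at most as many grid points as the span of
    the k longest sides.

    Upper bound: cover by cosets of W_k.  Adding the k-dimensional part of the
    grid to representatives x_a in K of distinct cosets gives distinct lattice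
    points of 2K.  Take coordinates with respect to a lattice basis adapted to
    the flag W_i, the i-th one modulo a power of two q_i ~ 4/mu_i.  Two points
    with the same residues differ by a point of 4K whose quotient by q_j (j its
    last nonzero coordinate) is a lattice point of gauge < mu_j outside W_j,
    which is impossible.  Hence there are at most prod q_i such points. *)

Require Import Defs.
From HB Require Import structures.
From mathcomp Require Import all_boot all_order all_algebra.
From mathcomp Require Import all_classical all_reals all_analysis.
From mathcomp Require Import zify ring lra.
Set Implicit Arguments. Unset Strict Implicit. Unset Printing Implicit Defensive.
Import Order.TTheory GRing.Theory Num.Theory numFieldNormedType.Exports.
Local Open Scope classical_set_scope.
Local Open Scope ring_scope.

(** * Dilates of a symmetric convex body and gauges of lattice points *)

Lemma scale_setZ (R : realType) (d : nat) (K : set 'rV[R]_d) (a l : R) x :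
  scale_set l K x -> scale_set (a * l) K (a *: x).
Proof. by move=> [y Ky <-]; exists y => //; rewrite scalerA. Qed.

Lemma scale_setN (R : realType) (d : nat) (K : set 'rV[R]_d) (l : R) x :
  symmetric_set K -> scale_set l K x -> scale_set l K (- x).
Proof. by move=> sK [y Ky <-]; exists (- y); [exact: sK|rewrite scalerN]. Qed.

Lemma scale_setD (R : realType) (d : nat) (K : set 'rV[R]_d) (a b : R) x y :
  Defs.convex_set K -> 0 <= a -> 0 <= b ->
  scale_set a K x -> scale_set b K y -> scale_set (a + b) K (x + y).
Proof.
move=> cK a0 b0 [u Ku <-] [v Kv <-].
have [/eqP|ab0] := eqVneq (a + b) 0.
  rewrite paddr_eq0 // => /andP[/eqP-> /eqP->].
  by exists u => //; rewrite !addr0 !scale0r addr0.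
have abp : 0 < a + b by rewrite lt_def ab0 addr_ge0.
exists (a / (a + b) *: u + (1 - a / (a + b)) *: v).
  apply: cK => //; rewrite divr_ge0 ?addr_ge0 //= ler_pdivrMr // mul1r.
  by rewrite lerDl.
rewrite scalerDr !scalerA; congr (_ *: _ + _ *: _); field; exact: ab0.
Qed.

Lemma scale_setS (R : realType) (d : nat) (K : set 'rV[R]_d) (a b : R) x :
  Defs.convex_set K -> K 0 -> 0 <= a <= b -> scale_set a K x -> scale_set b K x.
Proof.
move=> cK K0 /andP[a0 ab] aKx; rewrite -(subrKC a b) -[x]addr0.
apply: scale_setD; rewrite ?subr_ge0 //.
by exists 0 => //; rewrite scaler0.
Qed.

Lemma scale_set_sum (R : realType) (d : nat) (K : set 'rV[R]_d) (n : nat)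
    (a : 'I_n -> R) (x : 'I_n -> 'rV[R]_d) :
  Defs.convex_set K -> K 0 -> (forall i, 0 <= a i) ->
  (forall i, scale_set (a i) K (x i)) ->
  scale_set (\sum_i a i) K (\sum_i x i).
Proof.
move=> cK K0 a0 ax.
suff [] : 0 <= \sum_i a i /\ scale_set (\sum_i a i) K (\sum_i x i) by [].
elim/big_ind2 : _ => [|u p v q [u0 up] [v0 vq]|i _]; last by split.
  by split=> //; exists 0 => //; rewrite scaler0.
by split; [exact: addr_ge0|exact: scale_setD].
Qed.

Lemma sym_convex_body0 (R : realType) (d : nat) (K : set 'rV[R]_d) :
  sym_convex_body K -> K 0.
Proof.
move=> [_ cK sK [p [_ [Kp _ _]]]].
have := cK p (- p) 2^-1 _ Kp (sK _ Kp).
rewrite (_ : 1 - 2^-1 = 2^-1); last by field.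
by rewrite scalerN subrr; apply; lra.
Qed.

(** Differences of the affinely independent points of [K] lie in the dilate by 2 and form a basis;
    expanding [x] in this basis bounds its gauge by twice the sum of the absolute values of its
    coefficients. *)
Lemma sym_convex_body_absorbing (R : realType) (d : nat) (K : set 'rV[R]_d) x :
  sym_convex_body K -> exists2 l : R, 0 < l & scale_set l K x.
Proof.
move=> bK; have K0 := sym_convex_body0 bK.
case: bK => [_ cK sK [p [V [Kp Vf KV]]]].
have Vu : V \in unitmx by rewrite -row_free_unit.
pose c := x *m invmx V.
have KVj j : scale_set 2 K (row j V).
  have -> : row j V = (p + row j V) + - p by rewrite addrAC subrr add0r.
  rewrite (_ : 2 = 1 + 1) //.
  apply: scale_setD => //; first by exists (p + row j V); rewrite ?scale1r.
  by exists (- p); rewrite ?scale1r//; exact: sK.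
have xE : x = \sum_j c 0 j *: row j V by rewrite -mulmx_sum_row mulmxKV.
have Sx : scale_set (\sum_j `|c 0 j| * 2) K x.
  rewrite xE; apply: scale_set_sum => // j.
  have [cj|cj] := ger0P (c 0 j); first exact/scale_setZ/KVj.
  by rewrite -[c 0 j *: _]opprK -scaleNr; exact/scale_setN/scale_setZ/KVj.
have s0 : 0 <= \sum_j `|c 0 j| * 2 by apply: sumr_ge0 => j _; rewrite mulr_ge0.
(* The summand 1 keeps the factor positive when [x] is 0. *)
exists (\sum_j `|c 0 j| * 2 + 1); first by rewrite ltr_wpDl.
by apply: scale_setS Sx => //; rewrite s0 lerDl ler01.
Qed.

Lemma compact_rV_bounded (R : realType) (d : nat) (K : set 'rV[R]_d) :
  compact K -> exists2 M : R, 0 < M & forall x j, K x -> `|x 0 j| <= M.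
Proof.
move=> cK.
have H j : exists2 M : R, 0 < M & forall x, K x -> `|x 0 j| <= M.
  have /compact_bounded : compact [set (x : 'rV[R]_d) 0 j | x in K].
    by apply: continuous_compact => //; apply: continuous_subspaceT;
       exact: coord_continuous.
  move=> /pinfty_ex_gt0[M M0 HM].
  by exists M => // x Kx; apply: HM; exists x.
pose M j := s2val (cid2 (H j)).
have M0 j : 0 < M j by rewrite /M; case: cid2.
exists (1 + \sum_j M j) => [|x j Kx].
  by rewrite ltr_pwDl// sumr_ge0// => j _; exact: ltW.
have : `|x 0 j| <= M j by rewrite /M; case: cid2 => ? ? /= /(_ _ Kx).
move=> /le_trans; apply; rewrite (bigD1 j)//= addrCA lerDl addr_ge0// sumr_ge0//.
by move=> i _; exact: ltW.
Qed.

(* A nonzero lattice point has a coordinate at least 1 in absolute value with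
   respect to the basis, which bounds its gauge from below. *)
Lemma lattice_body_gap (R : realType) (d : nat) (L K : set 'rV[R]_d) :
  is_lattice L -> compact K ->
  exists2 e : R, 0 < e &
    forall l x, 0 < l -> L x -> scale_set l K x -> x != 0 -> e <= l.
Proof.
move=> [B [Bf ->]] /compact_rV_bounded[M M0 KM].
have Bu : B \in unitmx by rewrite -row_free_unit.
pose C := \sum_i \sum_j `|invmx B i j|.
have C0 : 0 <= C by apply: sumr_ge0 => i _; apply: sumr_ge0 => j _.
exists (M * (C + 1))^-1; first by rewrite invr_gt0 mulr_gt0// ltr_wpDl.
move=> l x l0 [z xz] [u Ku ux] x0.
have /rV0Pn[j zj] : z != 0.
  by apply: contra_neq x0; rewrite xz => ->; rewrite map_mx0 mul0mx.
have zE : (z 0 j)%:~R = \sum_i l * u 0 i * invmx B i j.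
  have : map_mx intr z = (l *: u) *m invmx B by rewrite ux xz mulmxK.
  by move=> /rowP/(_ j); rewrite !mxE => ->; apply: eq_bigr => i _; rewrite !mxE.
have : 1 <= `|(z 0 j)%:~R : R|.
  by rewrite -intr_norm (ler_int R 1) -gtz0_ge1 normr_gt0.
rewrite zE -[X in _ -> X <= _]mulr1 ler_pdivrMl ?mulr_gt0// ?ltr_wpDl//.
move=> /le_trans; apply.
apply: le_trans (ler_norm_sum _ _ _) _.
apply: (@le_trans _ _ (\sum_i M * l * `|invmx B i j|)).
  apply: ler_sum => i _; rewrite !normrM (gtr0_norm l0) [M * l]mulrC.
  by rewrite ler_wpM2r// ler_pM2l// KM.
rewrite -mulr_sumr mulrAC ler_pM2r// ler_pM2l// /C ler_wpDr//.
apply: ler_sum => i _; rewrite (bigD1 j)//= lerDl.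
exact: sumr_ge0.
Qed.

(** * Greedy flags of lattice vectors and successive minima *)

Definition prefix_mx (R : realType) (d : nat) (v : nat -> 'rV[R]_d) (n : nat) :
  'M[R]_(n, d) := \matrix_(l < n) v l.

(** When [W] spans v_0, ..., v_{i-1}, the infimum of this set is mu_i. *)
Definition gauges_outside (R : realType) (d m : nat) (L K : set 'rV[R]_d)
    (W : 'M[R]_(m, d)) : set R :=
  [set l | 0 < l /\ exists x, [/\ L x, scale_set l K x & ~~ (x <= W)%MS]].

Lemma prefix_mx_sub (R : realType) (d : nat) (v : nat -> 'rV[R]_d) i n :
  (i < n)%N -> (v i <= prefix_mx v n)%MS.
Proof. by move=> ilen; rewrite -(rowK v (Ordinal ilen)) row_sub. Qed.

Lemma prefix_mxS (R : realType) (d : nat) (v : nat -> 'rV[R]_d) i n :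
  (i <= n)%N -> (prefix_mx v i <= prefix_mx v n)%MS.
Proof.
move=> ilen; apply/row_subP => l; rewrite rowK prefix_mx_sub//.
exact: leq_trans ilen.
Qed.

Lemma prefix_mx_free (R : realType) (d : nat) (v : nat -> 'rV[R]_d) n :
  (forall i, (i < n)%N -> ~~ (v i <= prefix_mx v i)%MS) ->
  row_free (prefix_mx v n).
Proof.
move=> vN; rewrite -row_leq_rank; elim: n vN => [//|n IH] vN.
apply: leq_ltn_trans (IH _) _ => [i /ltnW|]; first exact: vN.
rewrite ltn_neqAle mxrankS ?prefix_mxS// andbT.
rewrite (mxrank_leqif_sup (prefix_mxS v (leqnSn n))).
apply: contra (vN n _) => //; apply: submx_trans.
exact: prefix_mx_sub.
Qed.

(** If all of [S] lay in the row space of [W], so would the differences from [p], which span i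
    dimensions. *)
Lemma affdim_ge_outside (R : realType) (d i m : nat) (S : set 'rV[R]_d)
    (W : 'M[R]_(m, d)) :
  affdim_ge S i -> (\rank W < i)%N -> exists2 x, S x & ~~ (x <= W)%MS.
Proof.
move=> [p [V [Sp Vf SV]]] rW; apply: contrapT => H.
have SW x : S x -> (x <= W)%MS.
  by move=> Sx; apply: contrapT => /negP xW; apply: H; exists x.
suff : (\rank V <= \rank W)%N by rewrite (eqP Vf) leqNgt rW.
apply/mxrankS/row_subP => j; rewrite -[row j V](addKr p).
apply: addmx_sub; last exact: SW.
by rewrite -scaleN1r; exact/scalemx_sub/SW.
Qed.

Lemma lattice0 (R : realType) (d : nat) (L : set 'rV[R]_d) :
  is_lattice L -> L 0.
Proof. by move=> [B [_ ->]]; exists 0; rewrite map_mx0 mul0mx. Qed.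

Lemma latticeD (R : realType) (d : nat) (L : set 'rV[R]_d) x y :
  is_lattice L -> L x -> L y -> L (x + y).
Proof.
move=> [B [_ ->]] [u ->] [v ->]; exists (u + v).
by rewrite map_mxD mulmxDl.
Qed.

Lemma lattice_natZ (R : realType) (d : nat) (L : set 'rV[R]_d) (n : nat) x :
  is_lattice L -> L x -> L (n%:R *: x).
Proof.
move=> lL Lx; elim: n => [|n IH]; first by rewrite scale0r; exact: lattice0.
by rewrite -natr1 scalerDl scale1r; exact: latticeD.
Qed.

Lemma lattice_sum (R : realType) (d n : nat) (L : set 'rV[R]_d)
    (x : 'I_n -> 'rV[R]_d) :
  is_lattice L -> (forall i, L (x i)) -> L (\sum_i x i).
Proof.
move=> lL Lx; apply: big_ind => //; first exact: lattice0.
by move=> u v; exact: latticeD.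
Qed.

(** A dilate large enough to hold every basis vector works, with the origin as base point. This
    makes the sets of gauges nonempty, so that their infima are meaningful. *)
Lemma lattice_body_full (R : realType) (d : nat) (L K : set 'rV[R]_d) :
  is_lattice L -> sym_convex_body K ->
  exists2 l : R, 0 < l & affdim_ge (L `&` scale_set l K) d.
Proof.
move=> lL bK; have K0 := sym_convex_body0 bK.
have L0 := lattice0 lL.
have [B [Bf LB]] := lL.
pose g j := s2val (cid2 (sym_convex_body_absorbing (row j B) bK)).
have g0 j : 0 < g j by rewrite /g; case: cid2.
have gK j : scale_set (g j) K (row j B) by rewrite /g; case: cid2.
have S0 : 0 <= \sum_j g j by apply: sumr_ge0 => j _; exact: ltW.
exists (1 + \sum_j g j); first by rewrite ltr_pwDl.
exists 0, B; split => // [|j]; first by split=> //; exists 0; rewrite ?scaler0.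
rewrite add0r; split.
  rewrite LB; exists (delta_mx 0 j); rewrite rowE; congr (_ *m _).
  by rewrite map_delta_mx.
have [_ cK _ _] := bK; apply: scale_setS (gK j) => //.
rewrite ltW//= (bigD1 j)//= addrCA lerDl addr_ge0// sumr_ge0// => i _.
exact: ltW.
Qed.

Lemma gauges_outside_lbound (R : realType) (d m : nat) (L K : set 'rV[R]_d)
    (W : 'M[R]_(m, d)) :
  has_lbound (gauges_outside L K W).
Proof. by exists 0 => l [/ltW]. Qed.

Lemma gauges_outside_neq0 (R : realType) (d m : nat) (L K : set 'rV[R]_d)
    (W : 'M[R]_(m, d)) :
  is_lattice L -> sym_convex_body K -> (m < d)%N ->
  gauges_outside L K W !=set0.
Proof.
move=> lL bK md; have [l l0 /affdim_ge_outside] := lattice_body_full lL bK.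
case/(_ _ W (leq_ltn_trans (rank_leq_row W) md)) => x [Lx Kx] xW.
by exists l; split=> //; exists x.
Qed.

Lemma inf_gauges_outside_gt0 (R : realType) (d m : nat) (L K : set 'rV[R]_d)
    (W : 'M[R]_(m, d)) :
  is_lattice L -> sym_convex_body K -> (m < d)%N ->
  0 < inf (gauges_outside L K W).
Proof.
move=> lL bK md; have [cK _ _ _] := bK.
have [e e0 eP] := lattice_body_gap lL cK.
apply: lt_le_trans e0 _; apply: lb_le_inf; first exact: gauges_outside_neq0.
move=> l [l0 [x [Lx Kx xW]]]; apply: (eP l x) => //.
by apply: contraNneq xW => ->; exact: sub0mx.
Qed.

Lemma greedy_vectors (R : realType) (d n : nat) (L K : set 'rV[R]_d) :
  is_lattice L -> sym_convex_body K -> (n <= d)%N ->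
  exists v : nat -> 'rV[R]_d, forall i, (i < n)%N ->
    [/\ L (v i), ~~ (v i <= prefix_mx v i)%MS &
        scale_set (2 * inf (gauges_outside L K (prefix_mx v i))) K (v i)].
Proof.
move=> lL bK; elim: n => [_|n IH nd]; first by exists (fun=> 0).
have [v vP] := IH (ltnW nd).
have m0 := inf_gauges_outside_gt0 (prefix_mx v n) lL bK nd.
(* The infimum is positive, so it may serve as its own error term: the point found has gauge below
   twice the infimum. *)
have [|l [l0 [x [Lx Kx xW]]] lm] :=
    inf_adherent (E := gauges_outside L K (prefix_mx v n)) m0.
  split; first exact: gauges_outside_neq0.
  exact: gauges_outside_lbound.
have [w [wn wv]] : exists w : nat -> 'rV[R]_d,
    w n = x /\ forall i, (i < n)%N -> w i = v i.
  exists (fun i => if i == n then x else v i); rewrite eqxx; split=> // i ilen.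
  by rewrite ltn_eqF.
have wE i : (i <= n)%N -> prefix_mx w i = prefix_mx v i.
  move=> ilen; apply/row_matrixP => j; rewrite !rowK wv//.
  exact: leq_trans ilen.
exists w => i; rewrite ltnS leq_eqVlt => /predU1P[->|ilen].
  rewrite wE// wn; split=> //.
  have K0 := sym_convex_body0 bK; have [_ cK _ _] := bK.
  by apply: scale_setS Kx => //; rewrite ltW//= mulr_natl mulr2n ltW.
by rewrite wE ?(ltnW ilen)// wv//; exact: vP.
Qed.

(* Settling for nearly minimal vectors, at the price of the factor 2, avoids
   proving that the infima are attained. *)
Lemma greedy_flag (R : realType) (d : nat) (L K : set 'rV[R]_d) :
  is_lattice L -> sym_convex_body K ->
  exists (v : nat -> 'rV[R]_d) (mu : nat -> R),
  [/\ forall i, (i < d)%N -> ~~ (v i <= prefix_mx v i)%MS,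
      forall i, (i < d)%N -> L (v i) /\ scale_set (2 * mu i) K (v i),
      forall i l x, (i < d)%N -> 0 < l < mu i -> L x -> scale_set l K x ->
        (x <= prefix_mx v i)%MS,
      forall i j, (i <= j < d)%N -> 0 < mu i <= mu j &
      forall i, (i < d)%N -> mu i <= succ_min L K i.+1 <= 2 * mu i].
Proof.
move=> lL bK; have [v vP] := greedy_vectors lL bK (leqnn d).
pose mu i := inf (gauges_outside L K (prefix_mx v i)).
have mu0 i : (i < d)%N -> 0 < mu i by exact: inf_gauges_outside_gt0.
have mulb i l : gauges_outside L K (prefix_mx v i) l -> mu i <= l.
  by apply: ge_inf; exact: gauges_outside_lbound.
have mono i j : (i <= j < d)%N -> mu i <= mu j.
  move=> /andP[ij jd]; apply: lb_le_inf; first exact: gauges_outside_neq0.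
  move=> l [l0 [x [Lx Kx xW]]]; apply: mulb; split=> //; exists x; split=> //.
  by apply: contra xW => /submx_trans; apply; exact: prefix_mxS.
have K0 := sym_convex_body0 bK; have [_ cK _ _] := bK.
have L0 := lattice0 lL.
exists v, mu; split.
- by move=> i /vP[].
- by move=> i /vP[].
- move=> i l x id /andP[l0 lm] Lx Kx; apply: contrapT => /negP xW.
  by move: lm; rewrite ltNge => /negP; apply; apply: mulb; split=> //; exists x.
- by move=> i j ijd; rewrite mono// mu0//; lia.
move=> i id.
(* The origin and v_0, ..., v_i all lie in the dilate by 2 mu_i, because mu is nondecreasing. *)
have Si : [set l : R | 0 < l /\ affdim_ge (L `&` scale_set l K) i.+1]
    (2 * mu i).
  split; first by rewrite mulr_gt0 ?mu0.
  exists 0, (prefix_mx v i.+1); split.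
  - by split=> //; exists 0; rewrite ?scaler0.
  - by apply: prefix_mx_free => j ji; case: (vP j); first exact: leq_trans id.
  move=> j; rewrite add0r rowK; have jd := leq_trans (ltn_ord j) id.
  have [Lj _ Kj] := vP j jd; split=> //; apply: scale_setS Kj => //.
  rewrite mulr_ge0 ?(ltW (mu0 j jd))//= ler_pM2l// mono//.
  by rewrite id -ltnS ltn_ord.
apply/andP; split.
  (* A set of affine dimension at least i+1 has a point outside W_i, whose rank is at most i. *)
  apply: lb_le_inf; first by exists (2 * mu i).
  move=> l [l0 /affdim_ge_outside/(_ (rank_leq_row (prefix_mx v i)))].
  by case=> x [Lx Kx] xW; apply: mulb; split=> //; exists x.
by apply: ge_inf => //; exists 0 => l [/ltW].
Qed.

(** * Lattice bases adapted to the flag *)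

(* Column Hermite form: clear the first row with the Smith form of that single
   row and recurse on the lower right block. *)
Lemma int_lower_triangularization (n : nat) (M : 'M[int]_n) :
  exists2 U : 'M[int]_n, U \in unitmx & is_trig_mx (M *m U).
Proof.
elim: n M => [|n IH] M.
  by exists 1%:M; [exact: unitmx1|apply/is_trig_mxP => -[]].
have [l _ [r ru [s _ rE]]] := int_Smith_normal_form (row 0 M).
pose A : 'M[int]_(1 + n) := M *m invmx r.
have A0 : ursubmx A = 0.
  apply/rowP => j; rewrite !mxE.
  transitivity ((row 0 M *m invmx r) 0 (rshift 1 j)).
    rewrite [RHS]mxE; apply: eq_bigr => i _; rewrite !mxE.
    by congr (M _ _ * _); apply/val_inj.
  rewrite rE mulmxK// !mxE big1// => i _; rewrite !mxE.
  by rewrite (ord1 i) /= mulr0.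
have [U Uu Ut] := IH (drsubmx A).
pose U1 : 'M[int]_(1 + n) := block_mx (1%:M : 'M[int]_1) 0 0 U.
have U1u : U1 \in unitmx by rewrite unitmxE det_ublock det1 mul1r -unitmxE.
exists (invmx r *m U1); first by rewrite unitmx_mul unitmx_inv ru U1u.
have AU : A *m U1 = block_mx (ulsubmx A) 0 (dlsubmx A) (drsubmx A *m U).
  rewrite -{1}[A]submxK A0 /U1 mulmx_block !mul0mx !mulmx0 !mulmx1.
  by rewrite !addr0 !add0r.
rewrite mulmxA; apply: (eq_ind_r (fun T : 'M[int]_(1 + n) => is_trig_mx T) _ AU).
rewrite is_trig_block_mx// eqxx Ut andbT /=.
by apply/is_trig_mxP => i j; rewrite !ord1.
Qed.

(** Let [M] hold the integer coordinates of the v_l in a basis [B0], and let [U] be unimodular with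
    [M *m U] lower triangular. In the basis obtained from [B0] by the inverse of [U], the
    coordinates of v_l form row l of [M *m U], so they vanish beyond index l. *)
Lemma adapted_basis (R : realType) (d : nat) (L : set 'rV[R]_d)
    (v : nat -> 'rV[R]_d) :
  is_lattice L -> (forall i, (i < d)%N -> L (v i)) ->
  exists B : 'M[R]_d, [/\ B \in unitmx, L = lattice_of B &
    forall n (x : 'rV[R]_d), (n <= d)%N -> (x <= prefix_mx v n)%MS ->
      forall i : 'I_d, (n <= i)%N -> (x *m invmx B) 0 i = 0].
Proof.
move=> [B0 [B0f LB]] vL; rewrite row_free_unit in B0f.
have zP (l : 'I_d) : exists z, v l = map_mx intr z *m B0.
  by move: (vL l (ltn_ord l)); rewrite LB.
pose M := \matrix_l sval (cid (zP l)).
have [U Uu MU] := int_lower_triangularization M.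
pose Ur : 'M[R]_d := map_mx intr U.
have UV : Ur *m map_mx intr (invmx U) = 1%:M.
  by rewrite -map_mxM mulmxV// map_mx1.
have [Uru _] := mulmx1_unit UV.
have VE : map_mx intr (invmx U) = invmx Ur by rewrite -[RHS]mulmx1 -UV mulKmx.
have Bu : invmx Ur *m B0 \in unitmx by rewrite unitmx_mul unitmx_inv Uru.
have invB : invmx (invmx Ur *m B0) = invmx B0 *m Ur.
  rewrite -[LHS]mulmx1 -[RHS](mulKmx Bu); congr (_ *m _).
  by rewrite -mulmxA mulKVmx// mulVmx.
exists (invmx Ur *m B0); split=> //.
  rewrite LB; apply/seteqP; split=> _ [z ->].
    exists (z *m U); rewrite map_mxM -mulmxA (mulmxA (map_mx _ U)).
    by rewrite mulmxV// mul1mx.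
  exists (z *m invmx U); rewrite map_mxM -mulmxA; congr (_ *m _).
  by rewrite VE.
move=> n x nd /submxP[c ->] i ni.
rewrite invB -mulmxA mxE big1// => l _.
have ld := leq_trans (ltn_ord l) nd.
suff -> : (prefix_mx v n *m (invmx B0 *m Ur)) l i = 0 by rewrite mulr0.
have -> : (prefix_mx v n *m (invmx B0 *m Ur)) l i
    = (v l *m invmx B0 *m Ur) 0 i.
  by rewrite -mulmxA [in RHS]mxE mxE; apply: eq_bigr => j _; rewrite !mxE.
have vl : v l *m invmx B0 = map_mx intr (row (Ordinal ld) M).
  rewrite rowK; case: cid => z /= vz.
  by rewrite (vz : v l = _) mulmxK.
rewrite vl -map_mxM -row_mul !mxE.
have /is_trig_mxP/(_ (Ordinal ld) i) := MU.
by rewrite mxE => -> //=; exact: leq_trans (ltn_ord l) ni.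
Qed.

(** * Counting coset representatives by residues *)

(** The type ['I_n.-1.+1] is inhabited for every n, as [inord] requires, and has exactly n elements
    once n is positive. *)
Definition residue (n : nat) (a : int) : 'I_n.-1.+1 := inord `|(a %% n)%Z|%N.

Lemma residue_eq (n : nat) (a b : int) :
  (0 < n)%N -> residue n a = residue n b -> (n %| a - b)%Z.
Proof.
move=> n0 /(congr1 val); rewrite /= !inordK.
- by rewrite -eqz_mod_dvd => /eqP ab; apply/eqP; lia.
- by rewrite prednK//; lia.
by rewrite prednK//; lia.
Qed.

Lemma prefix_sum (R : realType) (d n : nat) (v : nat -> 'rV[R]_d)
    (c : 'I_n -> R) :
  \sum_(i < n) c i *: v i = (\row_i c i) *m prefix_mx v n.
Proof.
by rewrite mulmx_sum_row; apply: eq_bigr => i _; rewrite mxE rowK.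
Qed.

Lemma prefix_sum_inj (R : realType) (d n : nat) (v : nat -> 'rV[R]_d)
    (c c' : 'I_n -> nat) :
  row_free (prefix_mx v n) ->
  \sum_(i < n) (c i)%:R *: v i = \sum_(i < n) (c' i)%:R *: v i -> c =1 c'.
Proof.
move=> vf; rewrite !(prefix_sum _ (fun i => _%:R)).
move=> /(row_free_inj vf)/rowP cc i.
by have := cc i; rewrite !mxE => /eqP; rewrite eqr_nat => /eqP.
Qed.

(** There are at most d summands, each of gauge at most 1/d. *)
Lemma grid_in_body (R : realType) (d n : nat) (L K : set 'rV[R]_d)
    (v : nat -> 'rV[R]_d) (c : 'I_n -> nat) :
  is_lattice L -> sym_convex_body K -> (n <= d)%N ->
  (forall i : 'I_n, L (v i)) ->
  (forall i : 'I_n, scale_set d%:R^-1 K ((c i)%:R *: v i)) ->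
  L (\sum_(i < n) (c i)%:R *: v i) /\
  scale_set 1 K (\sum_(i < n) (c i)%:R *: v i).
Proof.
move=> lL bK nd vL vK; split.
  by apply: lattice_sum => // i; exact: lattice_natZ.
have K0 := sym_convex_body0 bK; have [_ cK _ _] := bK.
apply: (@scale_setS _ _ _ (\sum_(i < n) d%:R^-1)) => //; last first.
  by apply: scale_set_sum => // i; rewrite invr_ge0.
rewrite sumr_const card_ord -[_ *+ n]mulr_natr mulr_ge0 ?invr_ge0//=.
have [->|d0] := posnP d; first by rewrite invr0 mul0r.
by rewrite ler_pdivrMl ?ltr0n// mulr1 ler_nat.
Qed.

(* Dividing [y] by the modulus at its last nonzero coordinate [j] gives a
   lattice point too short to have a nonzero coordinate [j]. *)
Lemma divisible_point_eq0 (R : realType) (d : nat) (L K : set 'rV[R]_d)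
    (v : nat -> 'rV[R]_d) (mu : nat -> R) (B : 'M[R]_d) (q : nat -> nat)
    (z : 'rV[int]_d) :
  L = lattice_of B -> B \in unitmx ->
  (forall n (x : 'rV[R]_d), (n <= d)%N -> (x <= prefix_mx v n)%MS ->
    forall i : 'I_d, (n <= i)%N -> (x *m invmx B) 0 i = 0) ->
  (forall i l x, (i < d)%N -> 0 < l < mu i -> L x -> scale_set l K x ->
    (x <= prefix_mx v i)%MS) ->
  (forall i, (i < d)%N -> (0 < q i)%N /\ 4 / (q i)%:R < mu i) ->
  (forall i j, (i <= j < d)%N -> (q j %| q i)%N) ->
  scale_set 4 K (map_mx intr z *m B) ->
  (forall i : 'I_d, (q i %| z 0%R i)%Z) -> z = 0.
Proof.
move=> LB Bu tri short qP qdvd zK zdvd; apply/eqP/contraT => /rV0Pn[i0 zi0].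
case: (@arg_maxnP _ i0 (fun i => z 0 i != 0) (fun i => i : nat) zi0) => j zj jmax.
have [q0 qmu] := qP j (ltn_ord j).
(* Beyond j the coordinates vanish; up to j, q_j divides q_i, which divides the coordinate. This is
   where the moduli must form a divisibility chain. *)
have zdvdj i : (q j %| z 0%R i)%Z.
  have [zi|/jmax ij] := eqVneq (z 0 i) 0; first by rewrite zi dvdz0.
  by apply: dvdz_trans (zdvd i); apply: qdvd; apply/andP; split.
pose w : 'rV[int]_d := \row_i (z 0%R i %/ q j)%Z.
have wE : map_mx intr w *m B = (q j)%:R^-1 *: (map_mx intr z *m B).
  rewrite scalemxAl; congr (_ *m _); apply/rowP => i; rewrite !mxE.
  rewrite -{2}(divzK (zdvdj i)) intrM mulrC mulfK//.
  by rewrite pnatr_eq0 -lt0n.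
have : (map_mx intr w *m B <= prefix_mx v j)%MS.
  apply: (short j (4 / (q j)%:R)) => //.
  - by rewrite divr_gt0 ?ltr0n.
  - by rewrite LB; exists w.
  by rewrite wE mulrC; exact: scale_setZ.
move=> /(tri j _ (ltnW (ltn_ord j)))/(_ j (leqnn j)).
rewrite mulmxK// !mxE => /eqP; rewrite intr_eq0 => /eqP wj.
by move: zj; rewrite -(divzK (zdvdj j)) wj mul0r eqxx.
Qed.

(** Pairs of a representative and a grid point of W_k inject into the vectors of residues: the
    residues determine the sum of the pair, its class modulo W_k determines the representative, and
    independence of the v_i determines the grid coordinates. *)
Lemma coset_count (R : realType) (d k s : nat) (L K : set 'rV[R]_d)
    (v : nat -> 'rV[R]_d) (mu : nat -> R) (N q : nat -> nat)
    (x : 'I_s -> 'rV[R]_d) :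
  is_lattice L -> sym_convex_body K -> (k <= d)%N ->
  (forall i, (i < d)%N -> L (v i)) ->
  (forall i, (i < d)%N -> ~~ (v i <= prefix_mx v i)%MS) ->
  (forall i l x, (i < d)%N -> 0 < l < mu i -> L x -> scale_set l K x ->
    (x <= prefix_mx v i)%MS) ->
  (forall i, (i < d)%N -> (0 < q i)%N /\ 4 / (q i)%:R < mu i) ->
  (forall i j, (i <= j < d)%N -> (q j %| q i)%N) ->
  (forall i m, (i < d)%N -> (m < N i)%N ->
    scale_set d%:R^-1 K (m%:R *: v i)) ->
  (forall a, L (x a) /\ K (x a)) ->
  (forall a b, (x a - x b <= prefix_mx v k)%MS -> a = b) ->
  (s * \prod_(i < k) N i <= \prod_(i < d) q i)%N.
Proof.
move=> lL bK kd vL vN short qP qdvd NP xP xsep.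
have [B [Bu LB tri]] := adapted_basis lL vL.
have K0 := sym_convex_body0 bK; have [_ cK sK _] := bK.
pose D := ('I_s * fprod (fun i : 'I_k => 'I_(N i)))%type.
pose E := fprod (fun i : 'I_d => 'I_(q i).-1.+1).
pose g (m : fprod (fun i : 'I_k => 'I_(N i))) : 'rV[R]_d :=
  \sum_(i < k) (m i : nat)%:R *: v i.
pose y (p : D) : 'rV[R]_d := x p.1 + g p.2.
have gP m : L (g m) /\ scale_set 1 K (g m).
  apply: grid_in_body => // i.
    by apply: vL; exact: leq_trans (ltn_ord i) kd.
  by apply: NP => //; exact: leq_trans (ltn_ord i) kd.
have yP p : L (y p) /\ scale_set 2 K (y p).
  have [Lx Kx] := xP p.1; have [Lg Kg] := gP p.2.
  split; first exact: latticeD.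
  rewrite (_ : 2 = 1 + 1)//; apply: scale_setD => //.
  by exists (x p.1) => //; rewrite scale1r.
(* The coordinates of a lattice point are already integers; [Num.floor] only changes their type. *)
pose co p : 'rV[int]_d := \row_i Num.floor ((y p *m invmx B) 0 i).
have coE p : y p = map_mx intr (co p) *m B.
  have [+ _] := yP p; rewrite LB => -[z yz].
  rewrite {1}yz; congr (map_mx _ _ *m _).
  by apply/rowP => i; rewrite mxE yz mulmxK// mxE intrKfloor.
pose f (p : D) : E := [fprod i : 'I_d => residue (q i) (co p 0 i)].
have : injective f.
  move=> p p' fpp; have yy : y p = y p'.
    apply/eqP; rewrite -subr_eq0 !coE -mulmxBl -map_mxB.
    suff -> : co p - co p' = 0 by rewrite map_mx0 mul0mx.
    apply: (divisible_point_eq0 LB Bu tri short qP qdvd).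
      rewrite map_mxB mulmxBl -!coE (_ : 4 = 2 + 2); last by ring.
      apply: scale_setD => //; first by have [] := yP p.
      by apply: scale_setN => //; have [] := yP p'.
    move=> i; have -> : (co p - co p') 0 i = co p 0 i - co p' 0 i.
      by rewrite !mxE.
    apply: residue_eq.
      by have [] := qP i (ltn_ord i).
    by have := congr1 (fun h : E => h i) fpp; rewrite !fprodE.
  (* Since the sums agree, the representatives differ by a difference of grid points, which lies in
     W_k. *)
  have p1 : p.1 = p'.1.
    apply: xsep; have -> : x p.1 - x p'.1 = g p'.2 - g p.2.
      have e : x p.1 + g p.2 = x p'.1 + g p'.2 := yy.
      by apply: (addIr (g p.2)); rewrite subrK addrAC e addrC addKr.
    rewrite /g !(prefix_sum _ (fun i => _%:R)) -mulmxBl; exact: submxMl.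
  have g2 : g p.2 = g p'.2 by move: yy; rewrite /y p1 => /addrI.
  have vf : row_free (prefix_mx v k).
    by apply: prefix_mx_free => i ik; apply: vN; exact: leq_trans ik kd.
  have := prefix_sum_inj vf g2 => h.
  case: p p' p1 h {fpp yy g2} => [a m] [a' m'] /= -> h; congr (_, _).
  by apply/fprodP => i; apply/val_inj/h.
move=> /leq_card; rewrite card_prod card_ord !card_fprod.
rewrite (eq_bigr (fun i : 'I_k => N i)); last by move=> i _; rewrite card_ord.
rewrite [X in (_ <= X)%N](eq_bigr (fun i : 'I_d => q i))// => i _.
by rewrite card_ord prednK//; have [] := qP i (ltn_ord i).
Qed.

(** * Grid points on affine subspaces: the lower bound *)

(** Exchange argument: with [A] the image of [h] and [I] the first k indices, the two set
    differences have equal size; factors over [A :\: I] are at most [N k], those over [I :\: A] at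
    least [N k]. *)
Lemma leq_prod_prefix (d k : nat) (N : nat -> nat) (h : 'I_k -> 'I_d) :
  (k < d)%N -> (forall i j, (i <= j < d)%N -> (N j <= N i)%N) -> injective h ->
  (\prod_(i < k) N (h i) <= \prod_(i < k) N i)%N.
Proof.
move=> kd Nmono hinj.
pose A := [set h i | i in [set: 'I_k]]%SET.
pose I := [set i : 'I_d | (i < k)%N]%SET.
have -> : (\prod_(i < k) N (h i) = \prod_(i in A) N i)%N.
  rewrite (big_imset (fun i : 'I_d => N i)) /=; last by move=> i j _ _ /hinj.
  by apply: eq_bigl => i; rewrite inE.
have IE (F : nat -> nat) : (\prod_(i < k) F i = \prod_(i in I) F i)%N.
  rewrite (eq_bigl (fun i : 'I_d => (i < k)%N)); last by move=> i; rewrite inE.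
  by rewrite (big_ord_narrow (ltnW kd)).
have cardAI : #|A :\: I| = #|I :\: A|.
  have cA : #|A| = k by rewrite card_imset// cardsT card_ord.
  have cI : #|I| = k.
    (* Applying [IE] to the constant 2 gives 2^k = 2^#|I|, hence the cardinality. *)
    by have := IE (fun=> 2%N); rewrite !prod_nat_const card_ord => /(expnI (ltnSn 1)).
  by rewrite !cardsD cA cI finset.setIC.
rewrite IE (big_setID I) [X in (_ <= X)%N](big_setID A) /= finset.setIC leq_mul2l.
apply/orP; right; apply: (@leq_trans (N k ^ #|A :\: I|)).
  rewrite -prod_nat_const; apply: leq_prod => i.
  by rewrite !inE -leqNgt => /andP[ki _]; apply: Nmono; rewrite ki ltn_ord.
rewrite cardAI -prod_nat_const; apply: leq_prod => i.
by rewrite !inE => /andP[_ ik]; apply: Nmono; rewrite kd ltnW.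
Qed.

(** In coordinates relative to the rows of [W], the direction space is the row space of a k by d
    matrix [A] of rank k. The map [h] selects k independent columns of [A], and these coordinates
    recover the parameter of a point of [F]. *)
Lemma affine_subspace_coords (R : realType) (d k : nat) (F : set 'rV[R]_d)
    (W : 'M[R]_d) :
  W \in unitmx -> affine_subspace k F ->
  exists2 h : 'I_k -> 'I_d, injective h &
    forall a b : 'rV[R]_d, F (a *m W) -> F (b *m W) ->
      (forall i, a 0 (h i) = b 0 (h i)) -> a = b.
Proof.
move=> Wu [p [V [Vf ->]]].
pose A := V *m invmx W.
have Af : row_full A^T.
  rewrite /row_full mxrank_tr.
  by rewrite mxrankMfree ?row_free_unit ?unitmx_inv.
have hA := fullrowsub_unit Af.
exists (fullrankfun Af); first exact: fullrankfun_inj.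
move=> a b [c _ ca] [c' _ cb] ab.
suff cc : c = c' by apply: (can_inj (mulmxK Wu)); rewrite -ca -cb cc.
have E : a - b = (c - c') *m A.
  rewrite /A mulmxA mulmxBl -[c *m V](addKr p) ca -[c' *m V](addKr p) cb.
  by rewrite opprD opprK addrACA addNr add0r -mulmxBl mulmxK.
have : (c - c') *m (rowsub (fullrankfun Af) A^T)^T = 0.
  apply/rowP => i.
  have := congr1 (fun u : 'rV[R]_d => u 0 (fullrankfun Af i)) E.
  rewrite !mxE ab subrr => e; rewrite [RHS]e; apply: eq_bigr => j _.
  by rewrite !mxE.
move/(congr1 (mulmx^~ (invmx (rowsub (fullrankfun Af) A^T)^T))).
by rewrite mulmxK ?unitmx_tr// mul0mx => /subr0_eq.
Qed.

Lemma covering_count (R : realType) (d k n : nat) (L K : set 'rV[R]_d)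
    (v : nat -> 'rV[R]_d) (N : nat -> nat) (F : 'I_n -> set 'rV[R]_d) :
  is_lattice L -> sym_convex_body K -> (k < d)%N ->
  (forall i, (i < d)%N -> L (v i)) ->
  (forall i, (i < d)%N -> ~~ (v i <= prefix_mx v i)%MS) ->
  (forall i, (0 < N i)%N) ->
  (forall i j, (i <= j < d)%N -> (N j <= N i)%N) ->
  (forall i m, (i < d)%N -> (m < N i)%N ->
    scale_set d%:R^-1 K (m%:R *: v i)) ->
  (forall j, affine_subspace k (F j)) -> covers F (L `&` K) ->
  (\prod_(k <= i < d) N i <= n)%N.
Proof.
move=> lL bK kd vL vN N0 Nmono NP Faff Fcov.
have Wf : row_free (prefix_mx v d) by apply: prefix_mx_free.
have Wu : prefix_mx v d \in unitmx by rewrite -row_free_unit.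
pose D := fprod (fun i : 'I_d => 'I_(N i)).
pose c (m : D) : 'rV[R]_d := \row_i (m i : nat)%:R.
pose g m := c m *m prefix_mx v d.
have gF m : exists j, F j (g m).
  apply: Fcov; rewrite /g /c -(prefix_sum _ (fun i => (m i : nat)%:R)).
  have [Lg Kg] : L (\sum_(i < d) (m i : nat)%:R *: v i) /\
      scale_set 1 K (\sum_(i < d) (m i : nat)%:R *: v i).
    by apply: grid_in_body => // i; [exact: vL|exact: NP].
  by split=> //; case: Kg => u Ku <-; rewrite scale1r.
pose f m := sval (cid (gF m)).
have fF m : F (f m) (g m) by rewrite /f; case: cid.
(* Each grid point is assigned to one subspace containing it; the points assigned to [F j] are
   determined by k of their grid coordinates. *)
have fibre j : (#|[set m | f m == j]%SET| <= \prod_(i < k) N i)%N.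
  have [h hinj hP] := affine_subspace_coords Wu (Faff j).
  apply: leq_trans (leq_prod_prefix kd Nmono hinj).
  pose r (m : D) : fprod (fun i : 'I_k => 'I_(N (h i))) :=
    [fprod i : 'I_k => m (h i)].
  have : {in [set m | f m == j]%SET &, injective r}.
    move=> m m'; rewrite !inE => /eqP mj /eqP mj' rr.
    have cc : c m = c m'.
      apply: hP; [by rewrite -mj; exact: fF|by rewrite -mj'; exact: fF|].
      move=> i; rewrite !mxE; congr (_%:R).
      have := congr1 (fun u : fprod (fun i : 'I_k => 'I_(N (h i))) => u i) rr.
      by rewrite !fprodE => ->.
    apply/fprodP => i; apply/val_inj.
    by have /rowP/(_ i) := cc; rewrite !mxE => /eqP; rewrite eqr_nat => /eqP.
  move=> /leq_card_in; rewrite card_fprod => /leq_trans; apply.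
  by apply: leq_prod => i _; rewrite card_ord.
have : (#|{: D}| <= n * \prod_(i < k) N i)%N.
  rewrite -sum1_card (partition_big f xpredT)//=.
  rewrite -[n in (n * _)%N]card_ord -sum_nat_const; apply: leq_sum => j _.
  by rewrite sum1dep_card; exact: fibre.
rewrite card_fprod (eq_bigr (fun i : 'I_d => N i)) => [|i _]; last first.
  by rewrite card_ord.
(* Splitting the grid size at k lets the first k sides cancel against the bound on a fibre. *)
rewrite -!(big_mkord xpredT) (big_cat_nat _ (n := k))//=; last exact: ltnW.
by rewrite mulnC leq_pmul2r// big_mkord prodn_gt0.
Qed.

(** * Covering by cosets, and the constants *)

(** The bound [M] gives a family of representatives of largest size; a point of [S] missed by their
    cosets could be appended to it. *)
Lemma maximal_coset_cover (R : realType) (d k M : nat) (S : set 'rV[R]_d)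
    (W : 'M[R]_(k, d)) :
  row_free W ->
  (forall s (x : 'I_s -> 'rV[R]_d), (forall a, S (x a)) ->
    (forall a b, (x a - x b <= W)%MS -> a = b) -> (s <= M)%N) ->
  exists (s : nat) (x : 'I_s -> 'rV[R]_d) (F : 'I_s -> set 'rV[R]_d),
    [/\ forall a, S (x a), forall a b, (x a - x b <= W)%MS -> a = b,
        forall a, affine_subspace k (F a) & covers F S].
Proof.
move=> Wf bound.
pose Q s := `[< exists x : 'I_s -> 'rV[R]_d,
  (forall a, S (x a)) /\ (forall a b, (x a - x b <= W)%MS -> a = b) >].
have Q0 : exists s, Q s by exists 0%N; apply/asboolP; exists (fun=> 0); split=> -[].
have QM s : Q s -> (s <= M)%N by move=> /asboolP[x [xS xW]]; exact: bound xW.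
case: (ex_maxnP Q0 QM) => s /asboolP[x [xS xW]] smax.
exists s, x, (fun a => [set x a + c *m W | c in setT]); split=> //.
  by move=> a; exists (x a), W.
move=> y yS; apply: contrapT => yF.
have yW a : ~~ (y - x a <= W)%MS.
  apply/negP => /submxP[c yc]; apply: yF; exists a, c => //.
  by rewrite -yc addrC subrK.
suff /smax : Q s.+1 by rewrite ltnn.
(* The new point [y] takes the last index, the old ones keep theirs. *)
apply/asboolP; exists (fun i => oapp x y (unlift ord_max i)); split.
  by move=> a; case: unliftP => [a'|] _ /=.
move=> a b; case: unliftP => [a'|] ->; case: unliftP => [b'|] -> //=.
- by move=> /xW ->.
- by rewrite -opprB eqmx_opp (negPf (yW _)).
by rewrite (negPf (yW _)).
Qed.

Lemma prod_const_div (R : fieldType) (k d : nat) (c : R) (f : nat -> R) :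
  \prod_(k <= i < d) (c / f i) = c ^+ (d - k) / \prod_(k <= i < d) f i.
Proof. by rewrite big_split /= prodr_const_nat prodfV. Qed.

(** The successor in the exponent puts q strictly above the integer part of 4/m, hence above 4/m,
    and costs at most a factor 2. The bound m <= 1 makes that integer part positive, as the
    logarithm needs. *)
Lemma trunc_log_between (R : realType) (m : R) :
  0 < m <= 1 -> let q := (2 ^ (trunc_log 2 (Num.truncn (4 / m))).+1)%N in
  4 / q%:R < m /\ q%:R <= 8 / m.
Proof.
move=> /andP[m0 m1] q; set t := Num.truncn (4 / m).
have fm : 1 <= 4 / m by rewrite ler_pdivlMr// mul1r (le_trans m1)// ler1n.
have f0 : 0 <= 4 / m by exact: le_trans fm.
have t0 : (0 < t)%N by rewrite truncn_gt0.
have /andP[tle tlt] := truncn_itv f0.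
have /andP[qle qlt] := trunc_log_bounds (ltnSn 1) t0.
split.
  rewrite ltr_pdivrMr ?ltr0n ?expn_gt0// mulrC -ltr_pdivrMr//.
  by apply: lt_le_trans tlt _; rewrite ler_nat.
rewrite (_ : 8 / m = 2 * (4 / m)); last by rewrite mulrA -natrM.
rewrite /q expnS natrM ler_pM2l//; apply: le_trans tle.
by rewrite ler_nat.
Qed.

Theorem theorem5 (R : realType) (d k : nat) :
  (1 <= k)%N -> (k <= d - 1)%N ->
  exists c1 c2 : R, [/\ 0 < c1, 0 < c2 &
    forall (L K : set 'rV[R]_d),
      is_lattice L -> sym_convex_body K ->
      succ_min L K d <= 1 ->
      let P := \prod_(k <= i < d) succ_min L K i.+1 in
      (exists (n : nat) (F : 'I_n -> set 'rV[R]_d),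
          [/\ forall j, affine_subspace k (F j),
              covers F (L `&` K) &
              n%:R <= c2 / P]) /\
      (forall (n : nat) (F : 'I_n -> set 'rV[R]_d),
          (forall j, affine_subspace k (F j)) ->
          covers F (L `&` K) ->
          c1 / P <= n%:R)].
Proof.
move=> k1 kd1; have kd : (k < d)%N by lia.
have d0 : (0 < d)%N by lia.
have d0R : 0 < d%:R :> R by rewrite ltr0n.
(* Below, each i >= k contributes N_i >= 1/(2 d lambda_{i+1}). Above, each i < k contributes
   (8/mu_i)(2 d mu_i) = 16 d, and each i >= k contributes 8/mu_i <= 16/lambda_{i+1}. *)
exists ((2 * d%:R)^-1 ^+ (d - k)), ((16 * d%:R) ^+ k * 16 ^+ (d - k)).
split; first by rewrite exprn_gt0// invr_gt0 mulr_gt0.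
  by rewrite mulr_gt0// exprn_gt0// mulr_gt0.
move=> L K lL bK lam1 P.
have K0 := sym_convex_body0 bK; have [_ cK _ _] := bK.
have [v [mu [vN vLK short mono mulam]]] := greedy_flag lL bK.
have vL i : (i < d)%N -> L (v i) by move=> /vLK[].
have mu0 i : (i < d)%N -> 0 < mu i.
  by move=> id; have /andP[] := mono i i (introT andP (conj (leqnn i) id)).
(* By monotonicity it suffices to bound mu_{d-1}, which is at most lambda_d. *)
have mu1 i : (i < d)%N -> mu i <= 1.
  move=> id; have dd : (d.-1 < d)%N by rewrite prednK.
  have /andP[_ /le_trans] := mono i d.-1 ltac:(lia); apply.
  have /andP[/le_trans + _] := mulam d.-1 dd; apply.
  by rewrite prednK.
(* [N i] counts the integers m with 0 <= m <= 1/(2 d mu_i); for these, m v_i has gauge at most 2 m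
   mu_i <= 1/d. *)
pose N i := (Num.truncn (2 * d%:R * mu i)^-1).+1.
pose q i := (2 ^ (trunc_log 2 (Num.truncn (4 / mu i))).+1)%N.
have N0 i : (0 < N i)%N by [].
have dmu0 i : (i < d)%N -> 0 < 2 * d%:R * mu i by move=> /mu0 ?; rewrite !mulr_gt0.
have Nmono i j : (i <= j < d)%N -> (N j <= N i)%N.
  move=> ijd; have /andP[i0 ij] := mono i j ijd.
  rewrite ltnS le_truncn// lef_pV2 ?posrE ?dmu0//; try lia.
  by rewrite ler_pM2l// mulr_gt0.
have Nlow i : (2 * d%:R * mu i)^-1 <= (N i)%:R by rewrite ltW// truncnS_gt.
have NP i m : (i < d)%N -> (m < N i)%N -> scale_set d%:R^-1 K (m%:R *: v i).
  move=> id mN; have [_ Kv] := vLK i id.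
  apply: scale_setS (scale_setZ m%:R Kv) => //.
  have m0 := mu0 i id.
  have -> /= : 0 <= m%:R * (2 * mu i) by rewrite mulr_ge0// mulr_ge0// ltW.
  have : m%:R <= (2 * d%:R * mu i)^-1.
    have u0 : 0 <= (2 * d%:R * mu i)^-1 by rewrite invr_ge0 ltW ?dmu0.
    have /andP[tle _] := truncn_itv u0.
    by apply: le_trans tle; rewrite ler_nat -ltnS.
  rewrite -[X in _ <= X -> _]mul1r ler_pdivlMr ?dmu0// => mle.
  rewrite -[X in _ <= X]mul1r ler_pdivlMr//.
  by rewrite (_ : m%:R * (2 * mu i) * d%:R = m%:R * (2 * d%:R * mu i)); last ring.
have qP i : (i < d)%N -> (0 < q i)%N /\ 4 / (q i)%:R < mu i.
  move=> id; split; first by rewrite expn_gt0.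
  by have [] := trunc_log_between (introT andP (conj (mu0 i id) (mu1 i id))).
have qup i : (i < d)%N -> (q i)%:R <= 8 / mu i.
  move=> id.
  by have [] := trunc_log_between (introT andP (conj (mu0 i id) (mu1 i id))).
have qdvd i j : (i <= j < d)%N -> (q j %| q i)%N.
  move=> ijd; have /andP[i0 ij] := mono i j ijd.
  rewrite dvdn_exp2l// ltnS leq_trunc_log// le_truncn// ler_pM2l//.
  by rewrite lef_pV2 ?posrE// (lt_le_trans i0).
split; last first.
  move=> n F Faff Fcov.
  have := covering_count lL bK kd vL vN N0 Nmono NP Faff Fcov.
  rewrite -(ler_nat R) natr_prod; apply: le_trans.
  rewrite -prod_const_div big_nat [X in _ <= X]big_nat.
  apply: ler_prod => i /andP[ki id].
  have /andP[ml lm] := mulam i id; have m0 := mu0 i id.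
  have l0 := lt_le_trans m0 ml.
  have -> /= : 0 <= (2 * d%:R)^-1 / succ_min L K i.+1.
    by rewrite ltW// divr_gt0// invr_gt0 mulr_gt0.
  apply: le_trans (Nlow i); rewrite [leRHS]invfM ler_pM2l ?invr_gt0 ?mulr_gt0//.
  by rewrite lef_pV2.
have Wf : row_free (prefix_mx v k).
  by apply: prefix_mx_free => i ik; apply: vN; exact: ltn_trans kd.
have count s (x : 'I_s -> 'rV[R]_d) : (forall a, (L `&` K) (x a)) ->
    (forall a b, (x a - x b <= prefix_mx v k)%MS -> a = b) ->
    (s * \prod_(i < k) N i <= \prod_(i < d) q i)%N.
  move=> xLK xsep.
  exact: (coset_count lL bK (ltnW kd) vL vN short qP qdvd NP xLK xsep).
(* The grid has at least one point, so [count] already yields the crude bound that makes a maximal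
   family exist; the full count is then applied to that family. *)
have [|s [x [F [xLK xsep Faff Fcov]]]] :=
    @maximal_coset_cover _ _ _ (\prod_(i < d) q i)%N (L `&` K) _ Wf.
  move=> s x xLK xsep; apply: leq_trans (count s x xLK xsep).
  by rewrite leq_pmulr// prodn_gt0.
exists s, F; split=> //.
have := count s x xLK xsep; rewrite -(ler_nat R) natrM !natr_prod => sle.
pose A : R := \prod_(i < k) (2 * d%:R * mu i)^-1.
have A0 : 0 < A.
  apply: prodr_gt0 => i _; rewrite invr_gt0 dmu0//.
  exact: ltn_trans kd.
have low : s%:R * A <= s%:R * \prod_(i < k) (N i)%:R.
  rewrite ler_wpM2l//; apply: ler_prod => i _; rewrite Nlow andbT.
  by rewrite invr_ge0 ltW// dmu0//; exact: ltn_trans kd.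
have up : \prod_(i < d) (q i)%:R <= \prod_(0 <= i < d) (8 / mu i) :> R.
  rewrite big_mkord; apply: ler_prod => i _; rewrite ler0n/=.
  exact: qup.
rewrite -(ler_pM2r A0); apply: le_trans low (le_trans sle (le_trans up _)).
rewrite (big_cat_nat _ (n := k))//=; last exact: ltnW.
(* The mu_i with i < k cancel against the grid size, leaving only the last d - k of them. *)
have -> : \prod_(0 <= i < k) (8 / mu i) = (16 * d%:R) ^+ k * A.
  rewrite big_mkord -[k in _ ^+ k]card_ord -prodr_const -big_split /=.
  apply: eq_bigr => i _; field.
  rewrite !gt_eqF// mu0//; exact: ltn_trans kd.
rewrite mulrAC ler_pM2r// -mulrA ler_pM2l; last by rewrite exprn_gt0// mulr_gt0.
rewrite -prod_const_div big_nat [X in _ <= X]big_nat.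
apply: ler_prod => i /andP[ki id].
have /andP[ml lm] := mulam i id; have m0 := mu0 i id.
have l0 := lt_le_trans m0 ml.
rewrite divr_ge0 ?(ltW m0)//= ler_pdivrMr// mulrAC ler_pdivlMr//.
by move: lm; lra.
Qed.
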